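(* Let $w=y_1\ldots y_k$ and $v=x_1\ldots x_n$ be non-empty words over $\{0,1\}$ with $y_k\ne x_n$. Every element $x\in\mathfrak{K}(w,v)$ which is a product, in any order, of all the generators $a_1,\dots,a_n,b_1,\dots,b_k$ of $\mathfrak{K}(w,v)$ (each generator occurring exactly once) has infinite order.
   Context: Automorphisms of the binary rooted tree $\{0,1\}^*$ act on the right. $\langle\langle g_0,g_1\rangle\rangle$ denotes the automorphism $0u\mapsto0u^{g_0}$, $1u\mapsto1u^{g_1}$; $\sigma$ exchanges $0$ and $1$ in the first letter; $\langle\langle g_0,g_1\rangle\rangle\sigma$ means first apply $\langle\langle g_0,g_1\rangle\rangle$, then $\sigma$. $\mathfrak{K}(w,v)$ is the subgroup of $\mathrm{Aut}(\{0,1\}^* )$ generated by $b_1,\dots,b_k,a_1,\dots,a_n$, where $b_1=\sigma$; for $1\le j<k$, $b_{j+1}=\langle\langle b_j,1\rangle\rangle$ if $y_j=0$ and $\langle\langle1,b_j\rangle\rangle$ if $y_j=1$; $a_1=\langle\langle b_k,a_n\rangle\rangle$ if $y_k=0,x_n=1$ and $a_1=\langle\langle a_n,b_k\rangle\rangle$ if $y_k=1,x_n=0$; for $1\le i<n$, $a_{i+1}=\langle\langle a_i,1\rangle\rangle$ if $x_i=0$ and $\langle\langle1,a_i\rangle\rangle$ if $x_i=1$. *)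

(* Defs.v *)
From HB Require Import structures.
From mathcomp Require Export all_boot.
From mathcomp Require Import boolp.

Set Implicit Arguments.
Unset Strict Implicit.
Unset Printing Implicit Defensive.

(* Vertices of the binary rooted tree are the words over {0,1}, written as
   [seq bool] with false for 0 and true for 1; the edges join u to u0 and u1. *)
Definition adjacent (u v : seq bool) : Prop :=
  exists c : bool, v = rcons u c \/ u = rcons v c.

(* The inverse is stored as data; it is determined by [act], see
   [tree_autP]. *)
Record tree_aut := TreeAut {
  act :> seq bool -> seq bool;
  act_inv : seq bool -> seq bool;
  actK : cancel act act_inv;
  act_invK : cancel act_inv act;
  act_root : act [::] = [::];
  act_adjacent : forall u v, adjacent (act u) (act v) <-> adjacent u v
}.

Lemma tree_autP (g h : tree_aut) : g =1 h -> g = h.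
Proof.
case: g h => [f f' fK f'K f0 fA] [g g' gK g'K g0 gA] /= efg.
have e : f = g by apply: funext.
have e' : f' = g' by apply: funext => u; rewrite -{1}(g'K u) -e fK.
by subst f' f; congr TreeAut; apply: Prop_irrelevance.
Qed.

Section Construction.
Variables f f' : seq bool -> seq bool.
Hypotheses (fK : cancel f f') (f'K : cancel f' f) (f0 : f [::] = [::]).
Hypothesis fS : forall u c, exists d, f (rcons u c) = rcons (f u) d.

Lemma child_adjacent u v : adjacent (f u) (f v) <-> adjacent u v.
Proof.
have f'S x d : exists c, f' (rcons x d) = rcons (f' x) c.
  case: (lastP (f' (rcons x d))) (f'K (rcons x d)) => [|y c] e.
    by move: e; rewrite f0; case: (x).
  have [d' e'] := fS y c; move: e; rewrite e' => /rcons_inj [<- _].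
  by exists c; rewrite fK.
split=> -[c [] e].
- by have [d ed] := f'S (f u) c; exists d; left; rewrite -(fK v) e ed fK.
- by have [d ed] := f'S (f v) c; exists d; right; rewrite -(fK u) e ed fK.
- by have [d ed] := fS u c; exists d; left; rewrite e.
- by have [d ed] := fS v c; exists d; right; rewrite e.
Qed.

Definition child_aut := TreeAut fK f'K f0 child_adjacent.
End Construction.

Lemma act_inv_root (g : tree_aut) : act_inv g [::] = [::].
Proof. by rewrite -{1}(act_root g) actK. Qed.

Lemma act_child (g : tree_aut) u c : exists d, g (rcons u c) = rcons (g u) d.
Proof.
have parent x d (h : tree_aut) :
    (exists d', h (rcons x d) = rcons (h x) d') \/
    (exists d', h x = rcons (h (rcons x d)) d').
  have /(act_adjacent h) [d' []] : adjacent x (rcons x d) by exists d; left.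
    by left; exists d'.
  by right; exists d'.
elim/last_ind: u c => [|u b IHu] c.
  have [//|[d]] := parent [::] c g.
  by rewrite act_root; case: (g _).
have [//|[d e]] := parent (rcons u b) c g.
have [b' eb] := IHu b; move: e; rewrite eb => /rcons_inj [e _].
by have /(can_inj (actK g))/(congr1 size)/eqP := e;
  rewrite !size_rcons -addn2 -{1}[size u]addn0 eqn_add2l.
Qed.

Definition aut_one : tree_aut.
Proof. by apply: (@child_aut id id) => // u c; exists c. Defined.

Definition aut_mul (g h : tree_aut) : tree_aut.
Proof.
apply: (@child_aut (fun u => h (g u)) (fun u => act_inv g (act_inv h u))).
- by move=> u; rewrite !actK.
- by move=> u; rewrite !act_invK.
- by rewrite !act_root.
- move=> u c; have [d ->] := act_child g u c.
  exact: act_child.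
Defined.

Definition aut_inv (g : tree_aut) : tree_aut.
Proof.
apply: (@TreeAut (act_inv g) g (act_invK g) (actK g)).
- exact: act_inv_root.
- by move=> u v; rewrite -(act_adjacent g) !act_invK.
Defined.

HB.instance Definition _ := gen_eqMixin tree_aut.
HB.instance Definition _ := gen_choiceMixin tree_aut.

Lemma aut_mulA : associative aut_mul.
Proof. by move=> f g h; apply: tree_autP. Qed.
Lemma aut_mul1 : left_id aut_one aut_mul.
Proof. by move=> f; apply: tree_autP. Qed.
Lemma aut_1mul : right_id aut_one aut_mul.
Proof. by move=> f; apply: tree_autP. Qed.
Lemma aut_mulV : left_inverse aut_one aut_inv aut_mul.
Proof. by move=> f; apply: tree_autP => u /=; rewrite act_invK. Qed.
Lemma aut_Vmul : right_inverse aut_one aut_inv aut_mul.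
Proof. by move=> f; apply: tree_autP => u /=; rewrite actK. Qed.

(* Automorphisms act on the right: g * h means first g, then h. *)
HB.instance Definition _ :=
  isGroup.Build tree_aut aut_mulA aut_mul1 aut_1mul aut_mulV aut_Vmul.

Lemma act_mul (g h : tree_aut) u : (g * h)%g u = h (g u).
Proof. by []. Qed.

Lemma act_one u : (1%g : tree_aut) u = u.
Proof. by []. Qed.

Definition sigma_fun (u : seq bool) : seq bool :=
  if u is c :: u' then ~~ c :: u' else [::].

Lemma sigma_funK : involutive sigma_fun.
Proof. by case=> //= c u; rewrite negbK. Qed.

Definition sigma : tree_aut.
Proof.
apply: (child_aut sigma_funK sigma_funK) => // -[|b u] c /=; last by exists c.
by exists (~~ c).
Defined.

Definition node_fun (f0 f1 : seq bool -> seq bool) (u : seq bool) : seq bool :=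
  if u is c :: u' then c :: (if c then f1 u' else f0 u') else [::].

(* node g0 g1 is <<g0, g1>>. *)
Definition node (g0 g1 : tree_aut) : tree_aut.
Proof.
apply: (@child_aut (node_fun g0 g1) (node_fun (act_inv g0) (act_inv g1))) => //.
- by case=> [|[] u] //=; rewrite actK.
- by case=> [|[] u] //=; rewrite act_invK.
- case=> [|b u] c /=; first by exists c; case: c; rewrite act_root.
  by case: b; [have [d ->] := act_child g1 u c | have [d ->] := act_child g0 u c];
    exists d.
Defined.

(* Words w = y_1 ... y_k and v = x_1 ... x_n are lists; indices start at 0, so
   [gen_b w j] is b_(j+1), [gen_a w v i] is a_(i+1), [nth false w j] is y_(j+1)
   and [nth false v i] is x_(i+1). *)
Fixpoint gen_b (w : seq bool) (j : nat) : tree_aut :=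
  if j is j'.+1 then
    if nth false w j' then node 1%g (gen_b w j') else node (gen_b w j') 1%g
  else sigma.

(* The recursion for the a_i is circular (a_1 involves a_n), but it determines
   their values on words by recursion on the length. Here beta is the action of
   b_k and y is y_k. Lemmas [gen_a0_01], [gen_a0_10] and [gen_aS] recover the
   defining equations. *)
Fixpoint a_fun (beta : seq bool -> seq bool) (y : bool) (v : seq bool)
    (i : nat) (u : seq bool) {struct u} : seq bool :=
  if u is c :: u' then
    c :: (if i is i'.+1 then
            if c == nth false v i' then a_fun beta y v i' u' else u'
          else if c == y then beta u' else a_fun beta y v (size v).-1 u')
  else [::].

Lemma a_funK (beta beta' : seq bool -> seq bool) y v i :
  cancel beta beta' -> cancel (a_fun beta y v i) (a_fun beta' y v i).
Proof.
move=> bK u; elim: u i => [|c u IHu] i //=.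
by case: i => [|i]; case: (c == _); rewrite ?bK ?IHu.
Qed.

Definition gen_a (w v : seq bool) (i : nat) : tree_aut.
Proof.
pose bk := gen_b w (size w).-1.
apply: (@child_aut (a_fun bk (last false w) v i)
                   (a_fun (act_inv bk) (last false w) v i)) => //.
- exact/a_funK/actK.
- exact/a_funK/act_invK.
- move=> u c; elim: u i => [|b u IHu] i /=.
    by exists c; case: i => [|i]; case: ifP; rewrite ?act_root.
  case: i => [|i]; case: ifP => _; last by exists c.
  + by have [d ->] := act_child bk u c; exists d.
  + by have [d ->] := IHu (size v).-1; exists d.
  + by have [d ->] := IHu i; exists d.
Defined.

Lemma gen_a0_01 w v : last false w = false -> last false v = true ->
  gen_a w v 0 = node (gen_b w (size w).-1) (gen_a w v (size v).-1).
Proof. by move=> yk _; apply: tree_autP => -[|[] u] //=; rewrite yk. Qed.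

Lemma gen_a0_10 w v : last false w = true -> last false v = false ->
  gen_a w v 0 = node (gen_a w v (size v).-1) (gen_b w (size w).-1).
Proof. by move=> yk _; apply: tree_autP => -[|[] u] //=; rewrite yk. Qed.

Lemma gen_aS w v i : gen_a w v i.+1 =
  if nth false v i then node 1%g (gen_a w v i) else node (gen_a w v i) 1%g.
Proof. by apply: tree_autP => -[|[] u] /=; case: (nth _ _ _). Qed.

Definition generators (w v : seq bool) : seq tree_aut :=
  [seq gen_a w v i | i <- iota 0 (size v)] ++
  [seq gen_b w j | j <- iota 0 (size w)].

(* The subgroup generated by S is the smallest one containing S. *)
Definition generated_by (G : groupType) (S : seq G) (x : G) : Prop :=
  forall H : groupClosed G, {subset S <= H} -> x \in H.

Definition frakK (w v : seq bool) : tree_aut -> Prop :=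
  generated_by (generators w v).

Definition infinite_order (G : groupType) (x : G) : Prop :=
  forall m : nat, 0 < m -> (x ^+ m)%g <> 1%g.

(* Main.v *)
From mathcomp Require Import zify.
Require Import Defs.

(** Among the generators only [b_1 = sigma] moves the first letter, so a product
    [x] of all of them, each taken once, has the form [node g0 g1 * sigma].
    Hence the odd powers of [x] exchange the two subtrees of the root, and
    [x ^+ 2 = node (g0 * g1) (g1 * g0)].  The reason why the argument can be
    repeated below the root is that every generator occurs exactly once as a
    coordinate of a generator other than [sigma]: [b_j] of [b_(j+1)], [a_i] of
    [a_(i+1)], and both [b_k] and [a_n] of [a_1].  Moving [sigma] to the right only swaps the
    coordinates of the factors that it passes, so all coordinates of all factors
    occur once in [g0 * g1].  Thus [g0 * g1] is again a product of all the
    generators in some order, apart from trivial factors ([square_coordinate]).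
    If [x ^+ m = 1] with [0 < m], then [m] is even and [(g0 * g1) ^+ m./2 = 1],
    and descent on [m] gives a contradiction ([self_similar_infinite_order]). *)

Set Implicit Arguments.
Unset Strict Implicit.
Unset Printing Implicit Defensive.

Local Open Scope group_scope.

Lemma node_mul g0 g1 h0 h1 :
  node g0 g1 * node h0 h1 = node (g0 * h0) (g1 * h1).
Proof. by apply: tree_autP => -[|[] u]. Qed.

Lemma node1 : node 1 1 = 1.
Proof. by apply: tree_autP => -[|[] u]. Qed.

Lemma sigma_node g0 g1 : sigma * node g0 g1 = node g1 g0 * sigma.
Proof. by apply: tree_autP => -[|[] u]. Qed.

Lemma sigma_sq : sigma * sigma = 1.
Proof. by apply: tree_autP => u; exact: sigma_funK. Qed.

Lemma node_eq1 g0 g1 : node g0 g1 = 1 -> g0 = 1.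
Proof.
move=> e; apply: tree_autP => u.
by have /= [->] := congr1 (fun g : tree_aut => g (false :: u)) e.
Qed.

Definition node_pair (p : tree_aut * tree_aut) : tree_aut := node p.1 p.2.

Definition coordinates (T : Type) (P : seq (T * T)) : seq T :=
  unzip1 P ++ unzip2 P.

Lemma coordinates_cons (T : eqType) (p : T * T) P :
  perm_eq (coordinates (p :: P)) ([:: p.1; p.2] ++ coordinates P).
Proof. by rewrite /coordinates /= perm_cons -[_ :: unzip2 P]cat1s perm_catCA. Qed.

Lemma coordinates_cat (T : eqType) (P Q : seq (T * T)) :
  perm_eq (coordinates (P ++ Q)) (coordinates P ++ coordinates Q).
Proof. by rewrite /coordinates /unzip1 /unzip2 !map_cat perm_catACA. Qed.

Lemma prod_node_pair P :
  \prod_(g <- map node_pair P) g =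
  node (\prod_(g <- unzip1 P) g) (\prod_(g <- unzip2 P) g).
Proof.
elim: P => [|p P IHP] /=; first by rewrite !big_nil node1.
by rewrite !big_cons IHP node_mul.
Qed.

Lemma expg_node_sigma g0 g1 m :
  (node g0 g1 * sigma) ^+ m =
  node ((g0 * g1) ^+ m./2) ((g1 * g0) ^+ m./2) *
  (if odd m then node g0 g1 * sigma else 1).
Proof.
have sq : (node g0 g1 * sigma) ^+ 2 = node (g0 * g1) (g1 * g0).
  rewrite expgS expg1 -mulgA [sigma * _]mulgA sigma_node !mulgA node_mul.
  by rewrite -mulgA sigma_sq mulg1.
have even_power h : (node g0 g1 * sigma) ^+ h.*2 =
    node ((g0 * g1) ^+ h) ((g1 * g0) ^+ h).
  rewrite -mul2n expgnA sq; elim: h => [|h IHh]; first by rewrite !expg0 node1.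
  by rewrite !expgS IHh node_mul.
rewrite -[in LHS](odd_double_half m) addnC expgnDr even_power.
by case: (odd m); rewrite ?expg1 ?expg0.
Qed.

(** Lets a rearrangement of automorphisms be followed on their coordinates,
    which are stored in lists of pairs. *)
Lemma perm_map_lift (T U : eqType) (x0 : T) (f : T -> U) s t :
  perm_eq s (map f t) -> exists2 t', perm_eq t' t & s = map f t'.
Proof.
case/(perm_iotaP (f x0)) => I; rewrite size_map => permI ->.
exists [seq nth x0 t i | i <- I]; first by apply/(perm_iotaP x0); exists I.
rewrite -map_comp; apply/eq_in_map => i.
by rewrite (perm_mem permI) mem_iota => /andP[_ lt_it] /=; rewrite (nth_map x0).
Qed.

Lemma perm_crossed_coordinates (T : eqType) (P Q1 Q2 : seq (T * T)) :
  perm_eq (Q1 ++ Q2) P ->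
  perm_eq ((unzip1 Q1 ++ unzip2 Q2) ++ (unzip2 Q1 ++ unzip1 Q2)) (coordinates P).
Proof.
move=> permQ; apply/permP => p.
have permC (f : T * T -> T) :
    (count p (map f Q1) + count p (map f Q2))%N = count p (map f P).
  by rewrite -count_cat -map_cat; apply/permP/perm_map.
rewrite /coordinates /unzip1 /unzip2 !count_cat -!permC; lia.
Qed.

(** Moving [sigma] to the end swaps the coordinates of the factors on its right,
    so the first coordinate of the square collects the first coordinates of the
    left factors and the second ones of the right factors, then the others. *)
Lemma square_coordinate P s :
  perm_eq s (sigma :: map node_pair P) ->
  exists g0 g1 t, [/\ \prod_(g <- s) g = node g0 g1 * sigma,
    perm_eq t (coordinates P) & g0 * g1 = \prod_(g <- t) g].
Proof.
move=> sP; have sigma_s : sigma \in s by rewrite (perm_mem sP) mem_head.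
case/splitPr: s / sigma_s sP => s1 s2 sP.
have : perm_eq (s1 ++ s2) (map node_pair P).
  by rewrite -(perm_cons sigma) -(permPr sP) perm_sym -cat1s perm_catCA.
case/(perm_map_lift (1, 1)) => Q permQ eQ.
pose P1 := take (size s1) Q; pose P2 := drop (size s1) Q.
have e1 : s1 = map node_pair P1 by rewrite map_take -eQ take_size_cat.
have e2 : s2 = map node_pair P2 by rewrite map_drop -eQ drop_size_cat.
exists (\prod_(g <- unzip1 P1 ++ unzip2 P2) g).
exists (\prod_(g <- unzip2 P1 ++ unzip1 P2) g).
exists ((unzip1 P1 ++ unzip2 P2) ++ (unzip2 P1 ++ unzip1 P2)); split.
- rewrite big_cat big_cons /= e1 e2 !prod_node_pair sigma_node mulgA node_mul.
  by rewrite !big_cat.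
- by apply: perm_crossed_coordinates; rewrite cat_take_drop.
- by rewrite [RHS]big_cat.
Qed.

(** Descent on the exponent: an odd power swaps the two subtrees of the root,
    and an even power acts on the left subtree as a power of half the exponent
    of a product of the same kind.  The factors [nseq l 1] absorb the trivial
    coordinates that accumulate during the descent. *)
Lemma self_similar_infinite_order S P n :
    perm_eq S (sigma :: map node_pair P) ->
    perm_eq (coordinates P) (S ++ nseq n 1) ->
  forall l s, perm_eq s (S ++ nseq l 1) -> infinite_order (\prod_(g <- s) g).
Proof.
move=> SP cP l s sS m; elim/ltn_ind: m l s sS => m IHm l s sS m_gt0.
have sP : perm_eq s (sigma :: map node_pair (P ++ nseq l (1, 1))).
  rewrite (permPl sS) map_cat map_nseq /node_pair /= node1 -cat_cons.
  by rewrite perm_cat2r.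
have [g0 [g1 [t [-> tP g01]]]] := square_coordinate sP.
rewrite expg_node_sigma; case odd_m: (odd m) => e.
  (* the vertex [:: false] is moved *)
  by have := congr1 (fun g : tree_aut => g [:: false]) e.
rewrite mulg1 in e.
have [m2_gt0 lt_m2] : 0 < m./2 /\ m./2 < m by lia.
(* each of the [l] old trivial factors contributes two trivial coordinates *)
apply: (IHm _ lt_m2 (n + (l + l))%N t) m2_gt0 _.
  rewrite (permPl tP); apply/permP => p; have /permP/(_ p) := cP.
  rewrite /coordinates /unzip1 /unzip2 !map_cat !map_nseq !nseqD !count_cat /=.
  lia.
by rewrite -g01; apply: node_eq1 e.
Qed.

Definition one_sided (c : bool) (g : tree_aut) : tree_aut * tree_aut :=
  if c then (1, g) else (g, 1).

Lemma coordinates_one_sided (c : nat -> bool) (h : nat -> tree_aut) I :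
  perm_eq (coordinates [seq one_sided (c i) (h i) | i <- I])
          (map h I ++ nseq (size I) 1).
Proof.
apply/permP => p; elim: I => //= i I; rewrite /coordinates !count_cat /=.
by case: (c i) => /=; lia.
Qed.

Lemma gen_a0 w v :
  gen_a w v 0 =
  node_pair (if last false w
             then (gen_a w v (size v).-1, gen_b w (size w).-1)
             else (gen_b w (size w).-1, gen_a w v (size v).-1)).
Proof. by case: ifP => yk; apply: tree_autP => -[|[] u] //=; rewrite yk. Qed.

Theorem proposition4p11 (w v : seq bool) (hw : w <> [::]) (hv : v <> [::])
    (hwv : last false w <> last false v)
    (x : tree_aut) (hx : frakK w v x)
    (s : seq tree_aut) (hs : perm_eq s (generators w v))
    (hxs : x = (\prod_(g <- s) g)%g) :
  infinite_order x.
Proof.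
rewrite hxs.
pose a := gen_a w v; pose b := gen_b w.
pose n := (size v).-1; pose k := (size w).-1.
have size_v : size v = n.+1 by rewrite /n; case: (v) hv.
have size_w : size w = k.+1 by rewrite /k; case: (w) hw.
pose a0 := if last false w then (a n, b k) else (b k, a n).
have a0E : a 0 = node_pair a0 by exact: gen_a0.
pose PA := [seq one_sided (nth false v i) (a i) | i <- iota 0 n].
pose PB := [seq one_sided (nth false w j) (b j) | j <- iota 0 k].
have one_sidedE c g :
    node_pair (one_sided c g) = if c then node 1 g else node g 1 by case: c.
have aE : map a (iota 0 n.+1) = node_pair a0 :: map node_pair PA.
  rewrite /= a0E (iotaDl 1 0) -!map_comp; congr (_ :: _).
  by apply: eq_map => i; rewrite /= one_sidedE -gen_aS.
have bE : map b (iota 0 k.+1) = sigma :: map node_pair PB.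
  rewrite /= (iotaDl 1 0) -!map_comp; congr (_ :: _).
  by apply: eq_map => j; rewrite /= one_sidedE.
apply: (@self_similar_infinite_order (generators w v) (a0 :: PA ++ PB) (n + k)
  _ _ 0) => //; last by rewrite cats0.
  rewrite /generators size_v size_w aE bE map_cons map_cat.
  by rewrite -[_ :: map _ PB]cat1s perm_catCA.
rewrite /generators size_v size_w -[n.+1]addn1 -[k.+1]addn1 !iotaD !map_cat.
have perm_P : perm_eq (coordinates (a0 :: PA ++ PB))
    ([:: a0.1; a0.2] ++ (map a (iota 0 n) ++ nseq n 1) ++
                        (map b (iota 0 k) ++ nseq k 1)).
  rewrite (permPl (coordinates_cons _ _)) perm_cat2l.
  rewrite (permPl (coordinates_cat _ _)).
  rewrite -{2}(size_iota 0 n) -{2}(size_iota 0 k).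
  by apply: perm_cat; apply: coordinates_one_sided.
rewrite (permPl perm_P) nseqD /a0 /= !add0n -/a -/b.
move: (map a _) (map b _) (a n) (b k) (nseq n 1) (nseq k 1) => A B x1 y1 N K.
by case: ifP => _; apply/permP => p; rewrite /= !count_cat /=; lia.
Qed.
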